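(* Let $D=(V,A)$ be a digraph on $n$ nodes and $k$ a positive integer. Let $m_{\rm in}:V\to\mathbb{Z}_+$ satisfy $0\le m_{\rm in}(v)\le\varrho_D(v)$ and $m_{\rm in}(v)\le k$ for each $v\in V$. Let $\mu_1,\dots,\mu_k$ be positive integers with $\mu_1+\cdots+\mu_k=\widetilde m_{\rm in}(V)$. There is a subgraph $(V,F)$ of $D$ which is the union of $k$ disjoint branchings $B_1,\dots,B_k$ with $|B_j|=\mu_j$ $(j=1,\dots,k)$ and with $\varrho_F(v)=m_{\rm in}(v)$ for each $v\in V$ if and only if $$\widetilde m_{\rm in}(Y)+\sum_{i=1}^q\varrho_D(V_i)\ge\sum_{j=1}^k[q+|Y|-(n-\mu_j)]^+$$ for every subset $Y\subseteq V$ and every subpartition $\{V_1,\dots,V_q\}$ of $V-Y$.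
   Context: A branching is a spanning subgraph (identified with its arc set) that is a directed forest in which every node has in-degree at most one; its size is its number of arcs. Branchings are disjoint if their arc sets are disjoint. $\varrho_D(X)$ (resp. $\varrho_F(X)$) is the number of arcs of $D$ (resp. of $F$) entering $X$, i.e. with tail outside $X$ and head in $X$; $\varrho_D(v)=\varrho_D(\{v\})$. $\widetilde m(Y)=\sum_{v\in Y}m(v)$, $x^+=\max\{x,0\}$. A subpartition is a family of pairwise disjoint nonempty subsets (possibly empty). *)

(* Defs.v *)
From mathcomp Require Import all_boot all_order all_algebra.

Set Implicit Arguments.
Unset Strict Implicit.
Unset Printing Implicit Defensive.

Local Open Scope nat_scope.

(* A digraph is given by a finite type [V] of nodes, a finite type [A] of arcs
   and two maps [tl hd : A -> V]; parallel arcs and loops are allowed.  A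
   spanning subgraph is identified with its arc set, of type [{set A}]. *)
Section Digraph.

Variables (V A : finType) (tl hd : A -> V).

(* A loop enters no set of nodes, so loops do not contribute to in-degrees. *)
Definition indeg (F : {set A}) (X : {set V}) : nat :=
  #|[set a in F | (tl a \notin X) && (hd a \in X)]|.

(* In the underlying undirected graph an arc can be traversed both ways:
   [(a, true)] goes from tail to head, [(a, false)] from head to tail. *)
Definition step_src (s : A * bool) : V := if s.2 then tl s.1 else hd s.1.
Definition step_dst (s : A * bool) : V := if s.2 then hd s.1 else tl s.1.

(* A circuit of the underlying undirected graph, without repeated arcs or
   nodes.  A loop is a circuit of length 1, and two parallel or opposite arcs
   form one of length 2. *)
Definition circuit (c : seq (A * bool)) : bool :=
  [&& c != [::],
      cycle (fun s t => step_dst s == step_src t) c,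
      uniq [seq s.1 | s <- c]
    & uniq [seq step_src s | s <- c]].

Definition forest (F : {set A}) : Prop :=
  ~ exists2 c, circuit c & {subset [seq s.1 | s <- c] <= F}.

Definition branching (B : {set A}) : Prop :=
  forest B /\ forall v : V, indeg B [set v] <= 1.

End Digraph.

(* Since the members are nonempty and pairwise disjoint, they are distinct, so
   a set of sets loses nothing over an indexed family and q is [#|P|]. *)
Definition subpartition (V : finType) (P : {set {set V}}) (X : {set V}) : bool :=
  [&& trivIset P, set0 \notin P & cover P \subset X].

Definition pospart (x : int) : int := Num.max x 0%R.

(* Main.v *)
Require Import Defs.
From mathcomp Require Import all_boot all_order all_algebra.
From mathcomp Require Import zify.
From Stdlib Require Import Classical.

Set Implicit Arguments.
Unset Strict Implicit.
Unset Printing Implicit Defensive.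

(* If [R_j] denotes the root set of [B_j], then [|R_j| = n - mu_j] and every
   node [v] lies in [k - m_in v] root sets.  By Edmonds' disjoint branchings
   theorem it suffices to find such sets with
   [#{j | R_j disjoint from X} <= c X] for all nonempty [X], where [c X] is the
   in-degree of [X] in [D], except that [c {v} = m_in v] at singletons; [c] is
   intersecting submodular, and the exception absorbs the set [Y] of the
   condition into the subpartition.  Viewing the membership relation as a set
   of edges between the indices [j] and the nodes, this asks that for all
   nonempty [J] and [X] at least [|J| - c X] edges join [J] to [X], and at least
   [n - mu_j] edges join [j] to the set of all nodes.  These demands are
   crossing bisupermodular, so the Frank-Jordan theorem provides the edges, in
   the right total number, as soon as every independent family of pairs
   [(J, X)] has small total demand; uncrossing reduces this to families with
   pairwise disjoint [X], for which it is the hypothesis. *)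

Local Open Scope nat_scope.

(** * Covering bisupermodular functions by edges *)

Lemma pairwise_or (T : eqType) (r : rel T) (s : seq T) :
  pairwise r s \/
  exists x y s', perm_eq s [:: x, y & s'] /\ ~~ r x y.
Proof.
elim: s => [|x s [IH|[y [z [s' [ss' nr]]]]]]; first by left.
- have [rx|] := boolP (all (r x) s); first by left; rewrite /= rx.
  rewrite -has_predC => /hasP[y ys nr]; right.
  by exists x, y, (rem y s); rewrite perm_cons perm_to_rem.
- right; exists y, z, (x :: s'); split=> //.
  apply: perm_trans (_ : perm_eq _ (x :: [:: y, z & s'])) _.
    by rewrite perm_cons.
  exact: (permEl (perm_catCA [:: x] [:: y; z] s')).
Qed.

Lemma perm_pairwise_sym (T : eqType) (r : rel T) (s t : seq T) :
  symmetric r -> perm_eq s t -> pairwise r s -> pairwise r t.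
Proof.
move=> rC.
elim: s t => [|x s IH] t; first by rewrite perm_sym => /perm_nilP ->.
move=> st /andP[xs ps].
have xt : x \in t by rewrite -(perm_mem st) mem_head.
have /splitPr : x \in t by []. move=> sp.
case: sp st xt => t1 t2 st _.
have st' : perm_eq s (t1 ++ t2).
  by rewrite -(perm_cons x); apply: perm_trans st _;
    rewrite perm_catC /= perm_cons perm_catC.
have := IH _ st' ps; rewrite !pairwise_cat /= allrel_consr.
move=> /and3P[-> -> ->]; rewrite !andbT.
move: xs; rewrite (perm_all _ st') all_cat => /andP[x1 ->]; rewrite andbT.
by rewrite andbT (eq_all (rC^~ x)).
Qed.

Section Covering.

Variables S T : finType.

Notation pair := ({set S} * {set T})%type.

Definition covers (e : S * T) (x : pair) : bool :=
  (e.1 \in x.1) && (e.2 \in x.2).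

(** Equivalently, no edge is covered by both pairs. *)
Definition indep (x y : pair) : bool :=
  [disjoint x.1 & y.1] || [disjoint x.2 & y.2].

Definition nonvoid (x : pair) : bool := (x.1 != set0) && (x.2 != set0).

Definition bimeet (x y : pair) : pair := (x.1 :&: y.1, x.2 :|: y.2).
Definition bijoin (x y : pair) : pair := (x.1 :|: y.1, x.2 :&: y.2).
Definition bile (x y : pair) : bool := (x.1 \subset y.1) && (y.2 \subset x.2).

Definition bisupermodular (p : pair -> int) : Prop :=
  forall x y, ~~ indep x y ->
    (p x + p y <= p (bimeet x y) + p (bijoin x y))%R.

Definition crossfree (x y : pair) : bool :=
  [|| indep x y, bile x y | bile y x].

(* Strictly increasing for [bile] and modular for [bimeet] and [bijoin], so that
   uncrossing increases the sum of its squares. *)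
Definition height (x : pair) : nat := #|x.1| + #|~: x.2|.

Lemma indep_sym : symmetric indep.
Proof. by move=> x y; rewrite /indep !(disjoint_sym (mem x.1)) !(disjoint_sym
  (mem x.2)). Qed.

Lemma height_le x : height x <= #|S| + #|T|.
Proof. exact: leq_add (max_card _) (max_card _). Qed.

Lemma height_meet_join x y :
  height (bimeet x y) + height (bijoin x y) = height x + height y.
Proof.
rewrite /height /= setCU setCI.
have := cardsUI x.1 y.1; have := cardsUI (~: x.2) (~: y.2); lia.
Qed.

Lemma height_bile x y : bile x y -> x = y \/ height x < height y.
Proof.
case: x y => [A X] [B Y] /andP[/= AB YX].
have [->|neAB] := eqVneq A B; have [->|neXY] := eqVneq X Y; [by left| | |];
  right; rewrite /height /=.
- by rewrite ltn_add2l; apply: proper_card;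
  rewrite properC properEneq eq_sym neXY.
- by rewrite ltn_add2r; apply: proper_card; rewrite properEneq neAB.
- rewrite -addSn; apply: leq_add; last by rewrite subset_leq_card // setCS.
  by apply: proper_card; rewrite properEneq neAB.
Qed.

Lemma height_meet x y :
  ~~ bile x y -> height (bimeet x y) < height x.
Proof.
have : bile (bimeet x y) x by rewrite /bile subsetIl subsetUl.
by move=> /height_bile[<-|//]; rewrite /bile subsetIr subsetUr.
Qed.

Lemma height_join x y :
  ~~ bile x y -> height y < height (bijoin x y).
Proof.
have : bile y (bijoin x y) by rewrite /bile subsetUr subsetIr.
by move=> /height_bile[->|//]; rewrite /bile subsetUl subsetIl.
Qed.

Lemma bimeetC x y : bimeet x y = bimeet y x.
Proof. by rewrite /bimeet setIC setUC. Qed.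

Lemma bijoinC x y : bijoin x y = bijoin y x.
Proof. by rewrite /bijoin setIC setUC. Qed.

Lemma covers_meet_join e x y :
  covers e (bimeet x y) + covers e (bijoin x y) <= covers e x + covers e y.
Proof.
rewrite /covers !inE.
by case: (e.1 \in x.1) (e.1 \in y.1) (e.2 \in x.2) (e.2 \in y.2) => [] [] [] [].
Qed.

Lemma nonindep_nonvoid x y :
  ~~ indep x y -> nonvoid (bimeet x y) && nonvoid (bijoin x y).
Proof.
rewrite /indep -!setI_eq0 negb_or /nonvoid /= => /andP[xy1 xy2].
rewrite xy1 xy2 !setU_eq0 andbT /=.
apply/andP; split; [apply: contra xy2|apply: contra xy1];
  by move=> /andP[/eqP-> _]; rewrite set0I.
Qed.

(** Two crossing members are replaced by their meet and join: by bisupermodularity the total value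
    does not drop, and no edge becomes covered more often. *)
Lemma uncross (p : pair -> int) (s : seq pair) :
  bisupermodular p -> all nonvoid s ->
  exists s', [/\ all nonvoid s', pairwise crossfree s',
    (\sum_(x <- s) p x <= \sum_(x <- s') p x)%R &
    forall e, count (covers e) s' <= count (covers e) s].
Proof.
move=> psup.
pose K := #|S| + #|T|.
have [m] := ubnP (\sum_(x <- s) (K * K - height x * height x)).
elim: m s => // m IH s sm nvs.
have [ps|[x [y [s0 [ss0 /norP[nxy /norP[lxy lyx]]]]]]] := pairwise_or crossfree s.
  by exists s.
have [] := IH [:: bimeet x y, bijoin x y & s0].
- have := sm; rewrite (perm_big _ ss0) /= !big_cons !addnA.
  have := height_meet_join x y; have := height_meet lxy; have := height_join lxy.
  have := height_meet lyx; rewrite bimeetC.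
  have := height_le (bijoin x y); rewrite -/K.
  set a := height x; set b := height y.
  set c := height (bimeet x y); set d := height (bijoin x y).
  set X := \sum_(j <- s0) _.
  move=> dK ca bd cb e.
  (* As [c] is below [a] and [b] and [a + b = c + d], strict convexity of the square gives the
     decrease; [d <= K] keeps the truncated subtractions exact. *)
  suff : (K * K - c * c) + (K * K - d * d) < (K * K - a * a) + (K * K
    - b * b) by lia.
  have : a * a + b * b < c * c + d * d by nia.
  have : d * d <= K * K by nia.
  have : a * a <= d * d by nia.
  have : b * b <= d * d by nia.
  have : c * c <= d * d by nia.
  lia.
- move: nvs; rewrite (perm_all _ ss0) /= => /and3P[_ _ ->].
  by have /andP[-> ->] := nonindep_nonvoid nxy.
move=> s' [nvs' ps' le cov]; exists s'; split=> //.
- apply: Order.POrderTheory.le_trans le.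
  rewrite (perm_big _ ss0) /= !big_cons.
  by rewrite !GRing.addrA Num.Theory.lerD2r; apply: psup.
- move=> e; apply: leq_trans (cov e) _.
  have /permP -> := ss0; rewrite /=.
  by rewrite !addnA leq_add2r; apply: covers_meet_join.
Qed.

(* The level of a pair is the length of the longest [bile]-chain above it; the
   members of a chain are all covered by one common edge. *)
Lemma antichain_levels (s : seq pair) :
  all nonvoid s -> pairwise crossfree s ->
  pairwise (relpre height leq) s ->
  exists l : seq (nat * pair),
    [/\ [seq a.2 | a <- l] = s,
        pairwise (fun a b => (a.1 == b.1) ==> indep a.2 b.2) l
      & forall a, a \in l -> exists2 t, t \in a.2.2 &
          forall s0, s0 \in a.2.1 -> a.1 < count (covers (s0, t)) s].
Proof.
elim: s => [|x s IH]; first by exists [::].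
move=> /= /andP[nvx nvs] /andP[cfx cfs] /andP[hx hs].
have [l [ls pl cov]] := IH nvs cfs hs.
pose i := \max_(a <- l | bile x a.2) a.1.+1.
have bnd a : a \in l -> bile x a.2 -> a.1 < i.
  by move=> al xa; rewrite /i;
    apply: (@leq_bigmax_seq _ l (fun a => bile x a.2) (fun a => a.1.+1) a).
exists ((i, x) :: l); split=> /=; first by rewrite ls.
- rewrite pl andbT; apply/allP=> a al /=; apply/implyP=> /eqP ia.
  have as_ : a.2 \in s by rewrite -ls map_f.
  have /or3P[//|xa|ax] := allP cfx _ as_; first by have := bnd _ al xa;
    rewrite ia ltnn.
  (* A member below [x] has at least the height of [x] by the sorting, so it equals [x] and also
     counts as lying above [x]. *)
  have := allP hx _ as_; rewrite /= leqNgt.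
  have [ax'|->//] := height_bile ax => _.
  have : bile x a.2 by rewrite ax' /bile !subxx.
  by move/(bnd _ al); rewrite ia ltnn.
- move=> a; rewrite inE => /predU1P[->|al] /=; last first.
    have [t tB tc] := cov a al; exists t => // s0 /tc lt.
    exact: leq_trans lt (leq_addl _ _).
  have covx t s0 : t \in x.2 -> s0 \in x.1
    -> covers (s0, t) x by rewrite /covers /= => -> ->.
  have [i0|] := posnP i.
    have /andP[_ /set0Pn[t tx]] := nvx.
    by exists t => // s0 s0x; rewrite i0 covx.
  move=> i_gt0.
  have [b bl /andP[xb ib]] : exists2 b, b \in l & bile x b.2 && (b.1.+1 == i).
    apply/hasP; apply: contraLR i_gt0 => /hasPn nb; rewrite -eqn0Ngt.
    rewrite -leqn0 leqNgt; apply/negP => i_gt1.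
    have : i <= i.-1.
      rewrite {1}/i big_seq_cond; apply/bigmax_leqP_seq => b _ /andP[bl xb].
      rewrite -ltnS (prednK i_gt1) ltn_neqAle (bnd _ bl xb) andbT.
      by have := nb _ bl; rewrite xb.
    by case: (i) i_gt1 => // j _; rewrite ltnn.
  (* The node [t] found for [b] serves for [x] too: [b] lies above [x], so [x] covers the edge from
     any element of [x.1] to [t], in addition to the members counted for [b]. *)
  have [t tB tc] := cov b bl.
  have /andP[xb1 xb2] := xb.
  have tx := subsetP xb2 _ tB.
  exists t => // s0 s0x; rewrite covx //= -(eqP ib).
  by rewrite add1n !ltnS; apply: tc; apply: (subsetP xb1).
Qed.

(** A member of level [i] covers an edge that is covered more than [i] times, so there are at most
    [m] levels; each level is an independent family, worth at most [nu]. *)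
Lemma crossfree_sum (p : pair -> int) (nu m : nat) (s : seq pair) :
  (forall t, all nonvoid t -> pairwise indep t ->
     (\sum_(x <- t) p x <= nu%:Z)%R) ->
  all nonvoid s -> pairwise crossfree s ->
  (forall e, count (covers e) s <= m) ->
  (\sum_(x <- s) p x <= (m * nu)%N%:Z)%R.
Proof.
move=> bnd nvs cfs cov.
pose s' := sort (relpre height leq) s.
have ss' : perm_eq s s' by rewrite perm_sym perm_sort.
have cfC : symmetric crossfree by move=> x y;
  rewrite /crossfree indep_sym orbCA orbA orbC orbA orbC orbCA.
have := @antichain_levels s'.
rewrite -(perm_all _ ss') => /(_ nvs (perm_pairwise_sym cfC ss' cfs)).
have tr : transitive (relpre height leq) by move=> ? ? ?; exact: leq_trans.
have tot : total (relpre height leq) by move=> x y; exact: leq_total.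
have := sort_sorted tot s; rewrite -/s' (sorted_pairwise tr) => hs /(_ hs).
move=> [l [ls pl lcov]].
have lvl a : a \in l -> a.1 < m.
  move=> al; have [t tB tc] := lcov a al.
  have : nonvoid a.2.
    by apply: (allP nvs); rewrite (perm_mem ss') -ls map_f.
  move=> /andP[/set0Pn[s0 s0A] _].
  by apply: leq_trans (tc _ s0A) _; have /permP <- := ss'.
rewrite (perm_big _ ss') -ls big_map /=.
have -> : (\sum_(a <- l) p a.2 = \sum_(i < m) \sum_(a <- l | a.1 == i) p a.2)%R.
  rewrite (exchange_big_dep xpredT) //= big_seq [RHS]big_seq.
  apply: eq_bigr => a al; rewrite (big_pred1 (Ordinal (lvl a al))) // => i.
have -> : ((m * nu)%:Z = \sum_(i < m) nu%:Z)%R.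
  by rewrite GRing.sumr_const card_ord; lia.
apply: Num.Theory.ler_sum => i _.
rewrite -big_filter -(big_map (fun a => a.2) xpredT p); apply: bnd.
  apply/allP => x /mapP[a]; rewrite mem_filter => /andP[_ al] ->.
  by apply: (allP nvs); rewrite (perm_mem ss') -ls map_f.
rewrite pairwise_map.
elim: l pl {ls lcov lvl} => //= a l IH /andP[al /IH pl].
case: eqP => //= ai; rewrite pl andbT.
apply/allP => b; rewrite mem_filter => /andP[/eqP bi bl].
by have := allP al _ bl; rewrite /= ai bi eqxx.
Qed.

Lemma indep_covers_le1 e (s : seq pair) :
  pairwise indep s -> count (covers e) s <= 1.
Proof.
elim: s => //= x s IH /andP[xs /IH].
case: (boolP (covers e x)) => // ex _.
rewrite add1n ltnS leqn0 eqn0Ngt -has_count.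
apply/hasPn => y ys; apply: contraTN (allP xs _ ys) => ey.
have [/andP[e1 e2] /andP[e3 e4]] := (ex, ey).
by rewrite /indep -!setI_eq0 negb_or; apply/andP; split; apply/set0Pn;
  [exists e.1|exists e.2]; rewrite inE ?e1 ?e2 ?e3 ?e4.
Qed.

(* Frank and Jordan.  If no edge may be chosen first, then for every edge [e] some
   independent family of value [nu] has no member covered by [e].  Uncross the
   union of these families, one per edge: every edge covers fewer members than
   there are edges, so it splits into fewer independent families than there
   are edges, one of which has value larger than [nu]. *)
Theorem covering (p : pair -> int) (nu : nat) :
  bisupermodular p ->
  (forall s, all nonvoid s -> pairwise indep s ->
     (\sum_(x <- s) p x <= nu%:Z)%R) ->
  exists2 es : seq (S * T), size es <= nu &
    forall x, nonvoid x -> (p x <= (count (covers^~ x) es)%:Z)%R.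
Proof.
elim: nu p => [|nu IH] p psup bnd.
  exists [::] => // x nvx; have := bnd [:: x].
  by rewrite /= nvx big_seq1; apply.
have [e0 _|noe] := pickP (xpredT : pred (S * T)); last first.
  exists [::] => // x /andP[/set0Pn[s0 _] /set0Pn[t0 _]].
  by have := noe (s0, t0).
pose q e x := (p x - (covers e x)%:Z)%R.
have [[e He]|He] := classic (exists e, forall s, all nonvoid s ->
  pairwise indep s -> (\sum_(x <- s) q e x <= nu%:Z)%R).
  have qsup : bisupermodular (q e).
    move=> x y nxy; have := psup _ _ nxy; have := covers_meet_join e x y.
    rewrite /q; lia.
  have [es ses esP] := IH _ qsup He.
  exists (e :: es) => // x nvx; have := esP x nvx; rewrite /q /=; lia.
(* Failure for [e] gives a family whose value minus its coverage of [e] exceeds [nu]; the value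
   being at most [nu.+1], the coverage is 0. *)
have {}He e : exists s, [/\ all nonvoid s, pairwise indep s,
    (nu.+1%:Z <= \sum_(x <- s) p x)%R & count (covers e) s = 0].
  apply: NNPP => nex; apply: He; exists e => s nvs ps.
  rewrite Order.TotalTheory.leNgt; apply/negP => lt; apply: nex; exists s.
  have := bnd s nvs ps; have := indep_covers_le1 e ps; move: lt.
  have -> : (\sum_(x <- s) q e x = \sum_(x <- s) p x - (count (covers e) s)%:Z)%R.
    elim: s {nvs ps} => [|x s IHs]; rewrite ?big_nil // !big_cons IHs /q /=; lia.
  move=> lt c1 sle; split=> //; lia.
have [s [nvs sum_s covs]] : exists s, [/\ all nonvoid s,
    ((#|{: S * T}| * nu.+1)%:Z <= \sum_(x <- s) p x)%R &
    forall e, count (covers e) s <= #|{: S * T}|.-1].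
  (* The families are joined edge by edge. The added term records that the family of [e] never
     covers [e], while any other covers it at most once. *)
  suff [s [nvs sum_s covs]] : exists s, [/\ all nonvoid s,
      ((size (enum {: S * T}) * nu.+1)%:Z <= \sum_(x <- s) p x)%R &
      forall e, count (covers e) s + (e \in enum {: S * T}) <=
        size (enum {: S * T})].
    exists s; rewrite -cardE in sum_s covs; split=> // e.
    by have := covs e; rewrite mem_enum inE addn1 => lt;
      rewrite -ltnS (ltn_predK lt).
  elim: (enum _) => [|e es [s [nvs sum_s covs]]].
    by exists [::]; split=> //; rewrite big_nil.
  have [t [nvt pt sum_t covt]] := He e.
  exists (t ++ s); split.
  - by rewrite all_cat nvt.
  - by rewrite big_cat /= mulSn PoszD; apply: Num.Theory.lerD.
  - move=> e'; rewrite count_cat inE /=.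
    have [->|_] /= := eqVneq e' e.
      by rewrite covt addn1 ltnS; apply: leq_trans (covs e); apply: leq_addr.
    rewrite -addnA -add1n; apply: leq_add (covs e').
    exact: indep_covers_le1.
have [s' [nvs' ps' le cov]] := uncross psup nvs.
have := crossfree_sum bnd nvs' ps' (fun e => leq_trans (cov e) (covs e)).
have : 0 < #|{: S * T}| by apply/card_gt0P; exists e0.
nia.
Qed.

End Covering.

Arguments covers {S T} e x.
Arguments nonvoid {S T} x.
Arguments indep {S T} x y.

(** * Branchings *)

Lemma uniq_map_inj (T1 T2 : eqType) (f : T1 -> T2) (s : seq T1) :
  uniq [seq f x | x <- s] -> {in s &, injective f}.
Proof.
elim: s => //= z s IH /andP[zs us] x y; rewrite !inE.
move=> /predU1P[->|xs] /predU1P[->|ys] //; last exact: IH.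
- by move=> e; case/mapP: zs; exists y.
- by move=> e; case/mapP: zs; exists x.
Qed.

Section Branchings.

Variables (V A : finType) (tl hd : A -> V).

Notation indeg := (indeg tl hd).
Notation forest := (forest tl hd).
Notation branching := (branching tl hd).

Definition enters (a : A) (X : {set V}) : bool := (tl a \notin X) && (hd a \in X).

Lemma indegE F X : indeg F X = \sum_(a in F) enters a X.
Proof.
rewrite /indeg -sum1dep_card big_mkcondr /=.
by apply: eq_bigr => a _; rewrite /enters; case: (_ && _).
Qed.

Lemma indeg_setT F : indeg F [set: V] = 0.
Proof. by rewrite indegE big1 // => a _; rewrite /enters inE. Qed.

Lemma indeg_submod F X Y :
  indeg F (X :&: Y) + indeg F (X :|: Y) <= indeg F X + indeg F Y.
Proof.
rewrite !indegE -!big_split /=; apply: leq_sum => a _.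
rewrite /enters !inE.
by case: (tl a \in X) (tl a \in Y) (hd a \in X) (hd a \in Y) => [] [] [] [].
Qed.

Lemma indegS (F G : {set A}) X : F \subset G -> indeg F X <= indeg G X.
Proof.
move=> /subsetP FG; apply: subset_leq_card; apply/subsetP => a.
by rewrite !inE => /andP[/FG-> ->].
Qed.

Lemma indegU1 a (F : {set A}) X :
  a \notin F -> indeg (a |: F) X = enters a X + indeg F X.
Proof. by move=> aF; rewrite !indegE big_setU1. Qed.

Lemma indeg_bigcup k (B : 'I_k -> {set A}) X :
  (forall i j, i != j -> [disjoint B i & B j]) ->
  indeg (\bigcup_(j < k) B j) X = \sum_(j < k) indeg (B j) X.
Proof.
move=> disjB; rewrite indegE partition_disjoint_bigcup //=.
by apply: eq_bigr => j _; rewrite indegE.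
Qed.

Lemma indeg1_gt0 B v :
  0 < indeg B [set v] -> exists2 a, a \in B & hd a = v.
Proof.
move=> /card_gt0P[a]; rewrite !inE => /and3P[aB _ /eqP hav].
by exists a.
Qed.

(** Otherwise every node of [X] is the head of an arc of [B], with tail in [X] because no arc enters
    [X]; following arcs backwards inside [X] closes a circuit. *)
Lemma forest_root B X :
  forest B -> X != set0 -> indeg B X = 0 ->
  exists2 v, v \in X & indeg B [set v] = 0.
Proof.
move=> forB X0 indX.
suff /exists_inP[v vX /eqP rv] :
  [exists v in X, indeg B [set v] == 0] by exists v.
apply: contraT => /exists_inPn noroot; case: forB.
have inarc v : v \in X -> exists a, [/\ a \in B, hd a = v & tl a \in X].
  move=> vX; have := noroot _ vX; rewrite -lt0n => /indeg1_gt0[a aB hav].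
  exists a; split=> //; apply/negPn/negP => taX.
  have : a \in [set a in B | (tl a \notin X) && (hd a \in X)].
    by rewrite !inE aB taX hav vX.
  by rewrite (cards0_eq indX) inE.
have [v0 v0X] := set0Pn _ X0; have [a0 _] := inarc _ v0X.
have [arc arcP] : exists arc : V -> A, forall v, v \in X ->
    [/\ arc v \in B, hd (arc v) = v & tl (arc v) \in X].
  apply: (@fin_all_exists V (fun=> A) (fun v a =>
    v \in X -> [/\ a \in B, hd a = v & tl a \in X])) => v.
  by have [/inarc[a aP]|_] := boolP (v \in X); [exists a|exists a0].
pose f v := tl (arc v).
pose closed Z := (Z != set0) && (f @: Z \subset Z).
have clX : closed X.
  rewrite /closed X0; apply/subsetP => w /imsetP[v vX ->].
  by have [_ _] := arcP _ vX.
(* On a minimal nonempty closed set [f] is a permutation, so an orbit is a cycle through distinct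
   nodes. *)
have [Z /minsetP[/andP[Z0 fZ] minZ] ZX] := minset_exists clX.
have fZE : f @: Z = Z.
  apply: minZ => //; rewrite /closed imsetS // andbT.
  by have [z zZ] := set0Pn _ Z0; apply/set0Pn; exists (f z); apply: imset_f.
have injf : {in Z &, injective f} by apply/imset_injP; rewrite fZE.
have homf : {homo f : x / x \in Z} by move=> x xZ; rewrite -fZE imset_f.
have [z zZ] := set0Pn _ Z0.
have orbZ x : x \in orbit f z -> x \in Z.
  move=> /trajectP[i _ ->].
  by elim: i => //= i; apply: homf.
have arcZ x : x \in orbit f z -> [/\ arc x \in B, hd (arc x) =
  x & tl (arc x) \in X].
  by move=> /orbZ /(subsetP ZX); apply: arcP.
exists [seq (arc x, false) | x <- orbit f z].
  rewrite /circuit -!map_comp /=.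
  have hdid : [seq hd (arc x) | x <- orbit f z] = orbit f z.
    by rewrite -[RHS]map_id; apply/eq_in_map => x /arcZ[].
  have uo := orbit_uniq f z.
  apply/and4P; split.
  - by rewrite -size_eq0 size_map size_orbit -lt0n order_gt0.
  - rewrite cycle_map.
    have := cycle_orbit_in homf injf zZ.
    apply: (@sub_in_cycle _ (mem (orbit f z))); last by apply/allP.
    move=> x y xo yo /=; rewrite /step_dst /step_src /= => /eqP <-.
    have fxo : f x \in orbit f z 
      by move: (xo : x \in orbit f z);
        rewrite -!fconnect_orbit => /connect_trans; apply; apply: fconnect1.
    by have [_ -> _] := arcZ _ fxo.
  - by apply: (@map_uniq _ _ hd); rewrite -map_comp hdid.
  - by rewrite (eq_map (_ : _ =1 (fun x => hd (arc x)))) // hdid.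
by move=> a; rewrite -map_comp => /mapP[x /arcZ[aB _ _] ->].
Qed.

Lemma forest_loopless B a : forest B -> a \in B -> tl a != hd a.
Proof.
move=> forB aB; apply/eqP => loop; apply: forB.
exists [:: (a, true)]; last by move=> b; rewrite /= inE => /eqP->.
by rewrite /circuit /= /step_dst /step_src /= loop eqxx.
Qed.

Definition roots (B : {set A}) : {set V} := [set v | indeg B [set v] == 0].

Lemma branching_card B : branching B -> #|roots B| + #|B| = #|V|.
Proof.
move=> [forB deg1].
have -> : #|B| = \sum_v indeg B [set v].
  under eq_bigr => v _ do rewrite indegE.
  rewrite exchange_big /= -sum1_card; apply: eq_bigr => a aB.
  rewrite (bigD1 (hd a)) //= /enters !inE eqxx (forest_loopless forB aB).
  by rewrite big1 ?addn0 // => v /negbTE nv;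
    rewrite !inE [hd a == v]eq_sym nv andbF.
rewrite -sum1_card big_mkcond -big_split -sum1_card /=; apply: eq_bigr => v _.
by rewrite inE; have := deg1 v; case: (indeg _ _) => [|[]].
Qed.

(** Each node of [Y] is a root or is entered by an arc, and each member of [P] contains a root or is
    entered by an arc. All these sets are disjoint, so no root is counted twice. *)
Lemma branching_bound B Y P :
  branching B -> subpartition P (~: Y) ->
  #|P| + #|Y| <= #|roots B| + (\sum_(v in Y) indeg B [set v] + \sum_(X in P)
    indeg B X).
Proof.
move=> [forB deg1] /and3P[trP P0 covP].
have hitY : #|Y| <= \sum_(v in Y) (v \in roots B) + \sum_(v in Y) indeg B [set v].
  rewrite -big_split -sum1_card; apply: leq_sum => v _ /=.
  by rewrite inE; case: (indeg _ _).
have hitP : #|P| <= \sum_(X in P) \sum_(v in X) (v \in roots B) + \sum_(X in P)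
  indeg B X.
  rewrite -big_split -sum1_card; apply: leq_sum => X XP /=.
  have X0 : X != set0 by apply: contraNneq P0 => <-.
  case indX: (indeg B X) => [|d]; last by rewrite addnS.
  have [v vX rv] := forest_root forB X0 indX.
  by rewrite (bigD1 v) //= inE rv.
rewrite -big_trivIset //= in hitP.
have : \sum_(v in Y) (v \in roots B) + \sum_(v in cover P) (v \in roots B) <=
  #|roots B|.
  have -> : #|roots B| = \sum_v (v \in roots B) by rewrite -sum1_card big_mkcond.
  rewrite [X in _ <= X](bigID (mem Y)) /= leq_add2l.
  rewrite [X in _ <= X]big_mkcond [X in X <= _]big_mkcond /=;
    apply: leq_sum => v _.
  by case: ifP => // /(subsetP covP); rewrite inE => ->.
move=> le; apply: leq_trans (leq_add hitP hitY) _.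
by rewrite addnACA [X in _ + X <= _]addnC leq_add2r addnC.
Qed.

(* [grows R B]: adding the arcs of [B] one at a time,
  each leaving the set of nodes
   reached so far, extends [R] to the whole node set. *)
Inductive grows : {set V} -> {set A} -> Prop :=
| grows_nil : grows setT set0
| grows_cons (R : {set V}) B a : tl a \in R -> hd a \notin R ->
    grows (hd a |: R) B -> grows R (a |: B).

Lemma grows_hd (R : {set V}) (B : {set A}) a :
  grows R B -> a \in B -> hd a \notin R.
Proof.
elim=> [|{}R {}B b tb hb _ IH]; first by rewrite inE.
rewrite !inE => /predU1P[->//|/IH].
by rewrite !inE negb_or => /andP[].
Qed.

Lemma grows_notin (R : {set V}) (B : {set A}) a :
  grows (hd a |: R) B -> a \notin B.
Proof. by move=> gB; apply/negP => /(grows_hd gB); rewrite setU11. Qed.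

Lemma grows_indeg (R : {set V}) B v : grows R B -> indeg B [set v] = (v \notin R).
Proof.
elim=> [|{}R {}B a ta ha gB IH]; first by rewrite indegE big_set0 inE.
rewrite (indegU1 _ (grows_notin gB)) IH /enters !inE negb_or [v == hd a]eq_sym.
have [<-|_] /= := eqVneq (hd a) v; last by rewrite andbF.
by rewrite ha addn0 andbT (contraTneq _ ta) // => ->.
Qed.

Lemma grows_card R B : grows R B -> #|R| + #|B| = #|V|.
Proof.
elim=> [|{}R {}B a ta ha gB IH]; first by rewrite cards0 cardsT addn0.
by rewrite cardsU1 (grows_notin gB) -IH cardsU1 ha addnCA addnA.
Qed.

Lemma grows_rank R (B : {set A}) : grows R B ->
  exists f : V -> nat, forall a, a \in B -> f (tl a) < f (hd a).
Proof.
elim=> [|{}R {}B a ta ha gB [f fP]].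
  by exists (fun=> 0) => a; rewrite inE.
(* The arc [a] goes from rank 0 to a positive rank; the other arcs have their heads outside [R], so
   shifting the remaining ranks by one preserves their increase. *)
exists (fun v => if v \in R then 0 else (f v).+1) => b.
rewrite !inE => /predU1P[->|bB]; first by rewrite ta (negbTE ha).
have := grows_hd gB bB; rewrite !inE negb_or => /andP[_ /negbTE->].
by case: ifP => // _; rewrite ltnS fP.
Qed.

(** At a node of largest rank on a circuit, both arcs of the circuit point into it, against
    in-degree at most one. *)
Lemma rank_forest (B : {set A}) (f : V -> nat) :
  (forall v, indeg B [set v] <= 1) ->
  (forall a, a \in B -> f (tl a) < f (hd a)) -> forest B.
Proof.
move=> deg1 fP [c /and4P[c0 cyc ua us] cB].
have cB1 s : s \in c -> s.1 \in B by move=> sc; apply: cB; apply: map_f.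
case: c c0 => // s0 c' _ in cyc ua us cB cB1 *.
set c := s0 :: c' in cyc ua us cB cB1.
have sc0 : s0 \in c by apply: mem_head.
have [s sc smax] : exists2 s, s \in c & forall t, t \in c
  -> f (step_src tl hd t) <= f (step_src tl hd s).
  have := @arg_maxnP _ s0 (mem c) (fun t => f (step_src tl hd t)) sc0.
  by case=> s sc smax; exists s.
have srcdst t : t \in c -> f (step_src tl hd t) <> f (step_dst tl hd t).
  move=> /cB1 /fP; rewrite /step_src /step_dst; case: t.2 => /=; lia.
set v := step_src tl hd s in smax.
have hs : hd s.1 = v.
  have /eqP := next_cycle cyc sc; have := smax (next c s);
    rewrite mem_next => /(_ sc).
  have := fP _ (cB1 _ sc).
  rewrite /v /step_dst /step_src; case: s.2 => //=.
  by move=> lt le e; rewrite -e in le; lia.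
set t := prev c s.
have tc : t \in c by rewrite mem_prev.
have /eqP tv : step_dst tl hd t == v := prev_cycle cyc sc.
have ht : hd t.1 = v.
  have := smax _ tc; have := fP _ (cB1 _ tc); rewrite -tv.
  by rewrite /step_dst /step_src; case: t.2 => //=; lia.
have ts : t.1 != s.1.
  apply/eqP => ts; have := srcdst _ sc.
  have : t = s by apply: (@uniq_map_inj _ _ fst c).
  by rewrite -/v -tv => ->.
have := deg1 v; rewrite leqNgt => /negP; apply.
rewrite /indeg (cardsD1 t.1) (cardsD1 s.1).
have enter u : u \in c -> hd u.1 = v -> (tl u.1 != v) by move=> /cB1/fP lt <-;
  apply: contraTneq lt => ->; rewrite ltnn.
by rewrite !inE ht hs !cB1 // !enter // eqxx [s.1 == _]eq_sym ts.
Qed.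

Lemma grows_branching R B : grows R B -> branching B.
Proof.
move=> gB; have deg1 v : indeg B [set v] <= 1.
  by rewrite (grows_indeg _ gB); case: (v \in R).
by have [f fP] := grows_rank gB; split=> //; apply: rank_forest fP.
Qed.

(** A branching with root set [R j] must enter every nonempty set disjoint from [R j], so this is
    the in-degree that a nonempty [X] requires. *)
Definition missing k (R : 'I_k -> {set V}) (X : {set V}) : nat :=
  \sum_(j < k) [disjoint R j & X].

(** Each indicator of disjointness is supermodular; at [j] its two terms on the left vanish, so
    disjointness from [X :&: Y] is pure gain. *)
Lemma missing_supermod k (R : 'I_k -> {set V}) j (X Y : {set V}) :
  ~~ [disjoint R j & X] -> ~~ [disjoint R j & Y] ->
  missing R X + missing R Y + [disjoint R j & X :&: Y]
    <= missing R (X :&: Y) + missing R (X :|: Y).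
Proof.
move=> jX jY.
rewrite -(big_pred1_eq addn j (fun i => nat_of_bool [disjoint R i & X :&: Y])).
rewrite big_mkcond -!big_split; apply: leq_sum => i _ /=.
have [->|_] := eqVneq i j; first by rewrite (negbTE jX) (negbTE jY) leq_addr.
rewrite addn0 -!setI_eq0 setIUr setU_eq0 setIA.
have [->|_] := eqVneq (R i :&: X) set0; first by rewrite set0I eqxx.
by rewrite setIAC; have [->|_] := eqVneq (R i :&: Y) set0; rewrite ?set0I ?eqxx.
Qed.

(* Edmonds' theorem, by Lovasz's argument: an arc leaving [R j1] inside a minimal
   tight set [X] that meets [R j1] without being contained in it can be given to
   the branching [j1]. *)
Theorem disjoint_branchings k (F : {set A}) (R : 'I_k -> {set V}) :
  (forall j, R j != set0) ->
  (forall X, X != set0 -> missing R X <= indeg F X) ->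
  exists B : 'I_k -> {set A}, [/\ forall j, B j \subset F,
    forall i j, i != j -> [disjoint B i & B j] & forall j, grows (R j) (B j)].
Proof.
have [n] := ubnP (\sum_(j < k) #|~: R j|).
elim: n F R => // n IH F R ltn R0 cond.
have [/forallP RT|] := boolP [forall j, R j == setT].
  exists (fun=> set0); split=> [j|i j _|j]; rewrite ?sub0set //.
    by rewrite -setI_eq0 set0I.
  by rewrite (eqP (RT j)); apply: grows_nil.
rewrite negb_forall => /existsP[j1 RT1].
pose crit X := [&& indeg F X <=
  missing R X, ~~ [disjoint R j1 & X] & ~~ (X \subset R j1)].
have critT : crit setT.
  by rewrite /crit indeg_setT -setI_eq0 setIT R0 subTset.
case: (arg_minnP (fun X : {set V} => #|X|) critT) =>
  X /and3P[tightX meetX outX] minX.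
(* [X :\: R j1] is missed by [R j1] and by every root set missing [X], so more arcs enter it; an
   extra one starts in [X :&: R j1]. *)
have ltX : indeg F X < indeg F (X :\: R j1).
  apply: leq_ltn_trans tightX _; apply: leq_trans (cond _ _);
    last by rewrite setD_eq0.
  rewrite /missing (bigD1 j1) //= [Z in _ < Z](bigD1 j1) //= (negbTE meetX) add0n.
  have -> : [disjoint R j1 & X :\: R j1] by rewrite
    -setI_eq0 setIDA setD_eq0 subsetIl.
  rewrite add1n ltnS; apply: leq_sum => i _.
  rewrite -!setI_eq0 setIDA; case: eqP => // ->.
  by rewrite set0D eqxx.
have [a /and3P[aF enta nenta]] :
  exists a, [&& a \in F, enters a (X :\: R j1) & ~~ enters a X].
  apply/existsP; apply: contraLR ltX => /existsPn none; rewrite -leqNgt !indegE.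
  apply: leq_sum => a aF; have := none a; rewrite aF /=.
  by case: (enters a _) => //= /negPn->.
have [hX hR] : hd a \in X /\ hd a \notin R j1.
  by move: enta; rewrite /enters !inE => /andP[_ /andP[]].
have [tX tR] : tl a \in X /\ tl a \in R j1.
  move: nenta enta; rewrite /enters !inE hX andbT negbK => -> /andP[].
  by rewrite andbT negbK.
pose R' j := if j == j1 then hd a |: R j1 else R j.
have R'1 : R' j1 = hd a |: R j1 by rewrite /R' eqxx.
have R'j j : j != j1 -> R' j = R j by rewrite /R' => /negbTE->.
have missingR' Y : missing R' Y + ((hd a \in Y) && [disjoint R j1 & Y]) =
  missing R Y.
  rewrite /missing (bigD1 j1) //= [RHS](bigD1 j1) //= R'1.
  rewrite (eq_bigr (fun j => nat_of_bool [disjoint R j & Y])) => [|j /R'j->//].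
  rewrite addnAC -!setI_eq0 setIUl setU_eq0 setI_eq0 disjoints1.
  by case: (hd a \in Y); case: eqP.
have aF' : a \notin F :\ a by rewrite setD11.
have indegF' Y : enters a Y + indeg (F :\ a) Y = indeg F Y.
  by rewrite -indegU1 // setD1K.
have [] := IH (F :\ a) R'.
- rewrite -ltnS; apply: leq_trans ltn;
  rewrite ltnS (bigD1 j1) //= [Z in _ < Z](bigD1 j1) //= R'1.
  rewrite (eq_bigr (fun j => #|~: R j|)) => [|j /R'j->//].
  rewrite -addSn leq_add2r; apply: proper_card; rewrite properC.
  by rewrite properEneq subsetUr andbT; apply: contraNneq hR => ->;
    rewrite setU11.
- by move=> j; rewrite /R'; case: ifP => // _; apply/set0Pn; exists (hd a);
  rewrite setU11.
- move=> Y Y0; have le : missing R' Y <=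
  missing R Y by rewrite -missingR' leq_addr.
  have := indegF' Y; case entY: (enters a Y) => /= eF; last first.
    by apply: leq_trans le _; rewrite add0n in eF; rewrite eF; apply: cond.
  have [tY hY] := andP entY; rewrite -ltnS -[X in _ < X]add1n eF.
  have [dY|meetY] := boolP [disjoint R j1 & Y].
    by rewrite (leq_trans _ (cond Y Y0)) // -missingR' hY dY addn1.
  (* Now [X] and [Y] are both tight and meet [R j1]. Either [X :&: Y] misses [R j1] and the gain
     contradicts submodularity, or [X :&: Y] satisfies [crit] and is smaller, as it omits [tl a]. *)
  apply: leq_ltn_trans le _; rewrite ltnNge; apply/negP => tightY.
  have XY0 : X :&: Y != set0 by apply/set0Pn; exists (hd a); rewrite inE hX.
  have XU0 : X :|: Y != set0 by apply/set0Pn; exists (hd a); rewrite inE hX.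
  have := indeg_submod F X Y; have := missing_supermod meetX meetY.
  have := cond _ XY0; have := cond _ XU0 => cU cI super sub.
  have [dXY|meetXY] := boolP [disjoint R j1 & X :&: Y].
    by move: super; rewrite dXY; clear -cU cI sub tightX tightY; lia.
  have : crit (X :&: Y).
    rewrite /crit meetXY; apply/andP; split.
      by clear -cU sub super tightX tightY; lia.
    by apply/subsetPn; exists (hd a); rewrite ?inE ?hX.
  move=> /minX; rewrite leqNgt => /negP; apply; apply: proper_card.
  rewrite properEneq subsetIl andbT; apply: contraNneq tY => XYX.
  by move: tX; rewrite -XYX inE => /andP[].
- move=> B' [B'F B'disj B'grows].
  have aB' j : a \notin B' j by apply: contraNN aF'; apply: (subsetP (B'F j)).
  exists (fun j => if j == j1 then a |: B' j else B' j); split=> [j|i j ij|j].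
  + have B'jF : B' j \subset F by apply: subset_trans (B'F j) _; apply: subsetDl.
    by case: ifP => // _; rewrite subUset sub1set aF.
  + have [ei|ni] := eqVneq i j1; have [ej|nj] := eqVneq j j1.
    * by move: ij; rewrite ei ej eqxx.
    * by rewrite -setI_eq0 setIUl setU_eq0 !setI_eq0 disjoints1 aB' B'disj.
    * by rewrite disjoint_sym
      -setI_eq0 setIUl setU_eq0 !setI_eq0 disjoints1 aB' B'disj // eq_sym.
    * exact: B'disj.
  + have := B'grows j; rewrite /R'; case: eqP => [->|//].
    exact: grows_cons.
Qed.

End Branchings.

(** * Root sets with prescribed sizes and degrees *)

Lemma pairwise_neq (T : eqType) (r : rel T) (s : seq T) x y :
  symmetric r -> pairwise r s -> x \in s -> y \in s -> x != y -> r x y.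
Proof.
move=> rC; elim: s => //= z s IH /andP[zs ps]; rewrite !inE.
move=> /predU1P[->|xs] /predU1P[->|ys]; rewrite ?eqxx //; last exact: IH.
- by move=> _; apply: (allP zs).
- by move=> _; rewrite rC; apply: (allP zs).
Qed.

Lemma count_sum_mem (T : finType) (P : pred T) (s : seq T) :
  count P s = \sum_(q | P q) count_mem q s.
Proof.
elim: s => [|x s IH] /=; first by rewrite big1.
rewrite big_split /= -IH; congr (_ + _).
rewrite big_mkcond (bigD1 x) //= eqxx big1 ?addn0 => [|q /negbTE qx].
  by case: (P x).
by rewrite eq_sym qx; case: (P q).
Qed.

Lemma eq_of_sum_geq (I : finType) (a b : I -> nat) :
  (forall i, a i <= b i) -> \sum_i b i <= \sum_i a i -> forall i, a i = b i.
Proof.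
move=> le ge i.
have := leqif_sum (P := xpredT) (fun j _ => leqif_eq (le j)).
move=> [le' eq']; move: eq'; rewrite eqn_leq le' ge => /esym/forallP/(_ i).
by move/eqP.
Qed.

Section RootSets.

Variables (V : finType) (k : nat) (c : {set V} -> nat) (r : 'I_k -> nat).

Notation pair := ({set 'I_k} * {set V})%type.

Hypothesis c_submod : forall X Y, X :&: Y != set0 ->
  c (X :&: Y) + c (X :|: Y) <= c X + c Y.

Definition excess (x : pair) : int := (#|x.1|%:Z - (c x.2)%:Z)%R.

(* If [X] and [X'] meet, then [A] and [A'] are disjoint and the pairs [(A, X)],
   [(A', X')] may be replaced by [(A :|: A', X :&: X')]; the union [X :|: X'] is
   dropped since [c] is nonnegative. *)
Lemma merge_indep (J : {set 'I_k}) (s : seq pair) :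
  all nonvoid s -> pairwise (indep) s -> all (fun x : pair => x.1 \subset J) s ->
  exists P : {set {set V}}, [/\ trivIset P, set0 \notin P &
    (\sum_(x <- s) excess x <=
       (#|J| * #|P|)%N%:Z - (\sum_(X in P) c X)%N%:Z)%R].
Proof.
have [n] := ubnP (size s).
elim: n s => // n IH s sn nvs ps sJ.
have [disj|[x [y [s' [ss' meet2]]]]] :=
  pairwise_or (fun x y : pair => [disjoint x.2 & y.2]) s.
  (* Disjoint nonempty second components are distinct, so they form [P] with one set per member, and
     each first component has at most [#|J|] elements. *)
  have nv x : x \in s -> x.2 != set0 by move=> /(allP nvs) /andP[].
  have us : uniq [seq x.2 | x <- s].
    elim: s disj nv {sn nvs ps sJ} => //= x s IHs /andP[xs /IHs us] nv.
    rewrite us ?andbT; last by move=> y ys; apply: nv; rewrite inE ys orbT.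
    apply/mapP => -[y ys xy]; have := allP xs _ ys;
      rewrite /= -xy -setI_eq0 setIid.
    by apply/negP; apply: nv; rewrite mem_head.
  exists [set X in [seq x.2 | x <- s]]; split.
  - apply/trivIsetP => X Y; rewrite !inE => /mapP[x xs ->] /mapP[y ys ->] xy.
    apply: (pairwise_neq _ disj) => // [u v|]; first exact: disjoint_sym.
    by apply: contraNneq xy => ->.
  - by rewrite inE; apply/mapP => -[x /nv x0 e]; rewrite -e eqxx in x0.
  - rewrite cardsE (card_uniqP us) size_map.
    rewrite (eq_bigl (mem [seq x.2 | x <- s])) => [|X]; last by rewrite inE.
    rewrite -big_uniq //= big_map.
    elim: s sJ {disj nv us sn nvs ps} => [|x s IHs] /=;
      first by rewrite !big_nil muln0.
    move=> /andP[xJ /IHs le]; rewrite !big_cons mulnS !PoszD GRing.opprD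
      GRing.addrACA.
    apply: Num.Theory.lerD le; rewrite /excess Num.Theory.lerD2r lez_nat.
    exact: subset_leq_card.
have pss := perm_pairwise_sym (@indep_sym _ _) ss' ps.
move: pss => /= /andP[/andP[xy xs'] /andP[ys' ps']].
have dxy : [disjoint x.1 & y.1] by move: xy; rewrite /indep (negbTE meet2) orbF.
have := nvs; rewrite (perm_all _ ss') /= => /and3P[/andP[x0 _] _ nvs'].
have := sJ; rewrite (perm_all _ ss') /= => /and3P[xJ yJ sJ'].
have meet2' : x.2 :&: y.2 != set0 by rewrite setI_eq0.
have [||||P [trP P0 le]] := IH ((x.1 :|: y.1, x.2 :&: y.2) :: s').
- by move: sn; rewrite (perm_size ss').
- by rewrite /= nvs' andbT /nonvoid /= meet2' andbT setU_eq0 (negbTE x0).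
- rewrite /= ps' andbT; apply/allP => z zs'.
  have := allP xs' _ zs'; have := allP ys' _ zs'; rewrite /indep /= -!setI_eq0.
  rewrite setIUl setU_eq0 -setIA.
  have [->|_] := eqVneq (y.2 :&: z.2) set0; first by rewrite setI0 eqxx !orbT.
  rewrite orbF => ->; rewrite andbT.
  rewrite setICA; have [->|_] := eqVneq (x.2 :&: z.2) set0;
    first by rewrite setI0 eqxx !orbT.
  by rewrite orbF => ->.
- by rewrite /= sJ' subUset xJ yJ.
exists P; split=> //; apply: Order.POrderTheory.le_trans le.
rewrite (perm_big _ ss') /= !big_cons GRing.addrA Num.Theory.lerD2r /excess /=.
have := c_submod meet2'; have := cardsUI x.1 y.1.
move: dxy; rewrite -setI_eq0 => /eqP ->; rewrite cards0 addn0 => -> le.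
rewrite GRing.addrACA -GRing.opprD
  -!PoszD Num.Theory.lerD2l Num.Theory.lerN2 lez_nat.
by apply: leq_trans le; apply: leq_addr.
Qed.

Hypothesis r_gt0 : forall j, 0 < r j.
Hypothesis sum_rc : \sum_j r j + \sum_v c [set v] = k * #|V|.
Hypothesis cond : forall (J : {set 'I_k}) (P : {set {set V}}),
  trivIset P -> set0 \notin P ->
  #|J| * #|P| <= \sum_(j in J) r j + \sum_(X in P) c X.

(* At [({j}, V)] the demand is raised to the prescribed size [r j]. *)
Definition special (x : pair) : bool := (#|x.1| == 1) && (x.2 == setT).

Definition demand (x : pair) : int :=
  if special x then Posz (\sum_(j in x.1) r j) else excess x.

Lemma special_eq x : special x -> exists j, x = ([set j], setT).
Proof.
case: x => [A X] /andP[/= /cards1P[j ->] /eqP ->].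
by exists j.
Qed.

Lemma special1 j : special ([set j], setT).
Proof. by rewrite /special /= cards1 !eqxx. Qed.

Lemma demand_ge x : (excess x <= demand x)%R.
Proof.
rewrite /demand; case: ifP => // /special_eq[j ->].
by rewrite /excess /= big_set1 cards1; have := r_gt0 j; lia.
Qed.

(** A special pair lies below every pair not independent of it, so raising its demand cannot spoil
    bisupermodularity. *)
Lemma special_meet_join x y : special x -> ~~ indep x y ->
  bimeet x y = x /\ bijoin x y = y.
Proof.
move=> /special_eq[j ->]; rewrite /indep negb_or /= disjoints1 negbK =>
  /andP[jy _].
by case: y jy => B Y /= jB;
  rewrite /bimeet /bijoin /= setTU setTI (setIidPl _) ?(setUidPr _) ?sub1set.
Qed.

Lemma demand_bisupermodular : bisupermodular demand.
Proof.
move=> x y nxy.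
have [spx|nspx] := boolP (special x).
  by have [-> ->] := special_meet_join spx nxy.
have [spy|nspy] := boolP (special y).
  have nyx : ~~ indep y x by rewrite indep_sym.
  by rewrite bimeetC bijoinC GRing.addrC;
    have [-> ->] := special_meet_join spy nyx.
apply: Order.POrderTheory.le_trans (Num.Theory.lerD (demand_ge _) (demand_ge _)).
rewrite /demand (negbTE nspx) (negbTE nspy) /excess /=.
rewrite [X in (X <= _)%R]GRing.addrACA [X in (_ <=
  X)%R]GRing.addrACA -!GRing.opprD -!PoszD [#|_ :&: _| + _]addnC cardsUI.
rewrite Num.Theory.lerD2l Num.Theory.lerN2 lez_nat addnC; apply: c_submod.
by move: nxy; rewrite /indep negb_or setI_eq0 => /andP[].
Qed.

(** Special pairs contribute [r j] for the indices outside [J]. Independence confines the other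
    pairs to [J], where merging and [cond] bound them by the sum of [r j] over [J]. *)
Lemma demand_indep s : all nonvoid s -> pairwise (indep) s ->
  (\sum_(x <- s) demand x <= (\sum_j r j)%N%:Z)%R.
Proof.
move=> nvs ps.
pose n j := count (fun x => special x && (j \in x.1)) s.
pose J := [set j | n j == 0].
have n1 j : n j <= 1.
  have [v _|noV] := pickP (@predT V).
    apply: leq_trans (indep_covers_le1 (j, v) ps); apply: sub_count => x.
    by move=> /andP[/andP[_ /eqP xT] jx]; rewrite /covers jx xT inE.
  suff : n j = 0 by move=> ->.
  apply/eqP; rewrite eqn0Ngt -has_count;
    apply/hasPn => x /(allP nvs) /andP[_ /set0Pn[v _]].
  by have := noV v.
have sumspec : (\sum_(x <- s | special x) demand x =
  (\sum_(j in ~: J) r j)%N%:Z)%R.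
  transitivity (Posz (\sum_j n j * r j)); last first.
    congr Posz; rewrite [RHS]big_mkcond; apply: eq_bigr => j _; rewrite !inE.
    by have := n1 j; case: (n j) => [|[|]]; rewrite ?mul0n ?mul1n.
  rewrite /n; elim: (s) => [|x t IH]; first by rewrite big_nil big1.
  rewrite big_cons /=; under [X in _ = Posz X]eq_bigr => j _ do rewrite mulnDl.
  rewrite big_split /= PoszD -IH; case: ifP => spx /=; last first.
    by rewrite [X in Posz X]big1 ?GRing.add0r // => j _; rewrite mul0n.
  congr (_ + _)%R; rewrite /demand spx; congr Posz.
  by rewrite big_mkcond; apply: eq_bigr => j _; case: (_ \in _); rewrite ?mul1n.
have [||| P [trP P0 le]] := @merge_indep J [seq x <- s | ~~ special x].
- by apply/allP => x; rewrite mem_filter => /andP[_ /(allP nvs)].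
- exact: pairwise_filter.
- apply/allP => x; rewrite mem_filter => /andP[nspx xs].
  apply/subsetP => j jx; rewrite inE eqn0Ngt -has_count.
  apply/hasPn => y ys; apply/negP => /andP[spy jy].
  have yx : y != x by apply: contraNneq nspx => <-.
  have := pairwise_neq (@indep_sym _ _) ps ys xs yx.
  have /andP[_ x0] := allP nvs _ xs.
  have [i yE] := special_eq spy; move: jy; rewrite yE !inE => /eqP ij.
  by rewrite /indep /= disjoints1 -ij jx -setI_eq0 setTI (negbTE x0).
rewrite (bigID special) /= sumspec.
have -> : (\sum_(x <- s | ~~ special x) demand x =
  \sum_(x <- [seq x <- s | ~~ special x]) excess x)%R.
  by rewrite big_filter; apply: eq_bigr => x; rewrite /demand => /negbTE->.
rewrite [X in (_ <= Posz X)%R](bigID (mem J)) /=.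
have -> : \sum_(j in ~: J) r j = \sum_(j < k | j \notin J) r j.
  by apply: eq_bigl => j; rewrite inE.
rewrite addnC PoszD Num.Theory.lerD2l; apply: Order.POrderTheory.le_trans le _.
by rewrite Num.Theory.lerBlDr -PoszD lez_nat; apply: cond.
Qed.

Theorem root_sets : exists R : 'I_k -> {set V},
  [/\ forall j, #|R j| = r j,
      forall v, \sum_j (v \notin R j) = c [set v]
    & forall X, X != set0 -> missing R X <= c X].
Proof.
have [es size_es esP] := covering demand_bisupermodular demand_indep.
pose z j v := count_mem (j, v) es.
have countE (A : {set 'I_k}) (X : {set V}) :
  count (covers^~ (A, X)) es = \sum_(j in A) \sum_(v in X) z j v.
  by rewrite count_sum_mem pair_big; apply: eq_big => [[]|[]].
have covP (A : {set 'I_k}) (X : {set V}) : A != set0 -> X != set0 ->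
    #|A| <= \sum_(j in A) \sum_(v in X) z j v + c X.
  move=> A0 X0; have := esP (A, X); rewrite /nonvoid /= A0 X0 => /(_ isT).
  move=> le; have := Order.POrderTheory.le_trans (demand_ge (A, X)) le.
  by rewrite countE /excess /=; lia.
have size_esE : size es = \sum_j \sum_v z j v.
  by rewrite pair_big -count_predT count_sum_mem; apply: eq_bigr => [[]].
(* The special demand gives at least [r j] edges at [j]; since there are at most [\sum_j r j] edges
   in all, equality holds. *)
have rowE j : r j = \sum_v z j v.
  move: j; apply: eq_of_sum_geq; last by rewrite -size_esE.
  move=> j; have [v _|noV] := pickP (@predT V).
    have := esP ([set j], setT); rewrite /nonvoid /= -!card_gt0 cards1 cardsT.
    have -> : 0 < #|V| by apply/card_gt0P; exists v.
    move=> /(_ isT); rewrite countE /demand special1 /= !big_set1.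
    by rewrite (eq_bigl xpredT) // => u; rewrite inE.
  have : \sum_j r j = 0.
    by have := sum_rc; rewrite (eq_card0 noV) muln0; lia.
  by move/eqP; rewrite sum_nat_eq0 => /forallP/(_ j); have := r_gt0 j;
    case: (r j).
(* The demand between all indices and [v] gives one inequality; summed over [v], [sum_rc] forces
   equality. *)
have colE v : k = \sum_j z j v + c [set v].
  have kC : k * #|V| = \sum_(v : V) k by rewrite sum_nat_const mulnC.
  move: v; apply: (@eq_of_sum_geq V (fun=> k)).
    move=> v; have [j _|noK] := pickP (@predT 'I_k); last first.
      by rewrite -[X in X <= _]card_ord (eq_card0 noK).
    have := @covP setT [set v]; rewrite -!card_gt0 cards1 cardsT card_ord.
    rewrite (leq_ltn_trans (leq0n j) (ltn_ord j)) => /(_ isT isT).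
    by rewrite (eq_bigr (z^~ v)) => [|i _];
      rewrite ?big_set1 // (eq_bigl xpredT) // => i; rewrite inE.
  by rewrite big_split /= exchange_big /= -size_esE -kC -sum_rc leq_add2r.
(* Subtracting the demand between [v] and all indices but [j] from [colE] leaves at most one edge,
   so the edges do define sets [R j]. *)
have z1 j v : z j v <= 1.
  have := colE v; rewrite (bigD1 j) //= => kE.
  have cC : #|~: [set j]| + 1 =
    k by rewrite -[RHS]card_ord -(cardsC [set j]) cards1 addnC.
  have sumC : \sum_(i in ~: [set j]) \sum_(u in [set v]) z i u =
    \sum_(i < k | i != j) z i v.
    by apply: eq_big => [i|i _]; rewrite ?inE ?big_set1.
  have le : #|~: [set j]| <= \sum_(i < k | i != j) z i v + c [set v].
    have := @covP (~: [set j]) [set v]; rewrite sumC -!card_gt0 cards1.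
    by case: (posnP #|~: [set j]|) => [->//|_ /(_ isT isT)].
  rewrite -(leq_add2r (\sum_(i < k | i != j) z i v + c [set v])) addnA.
  apply: leq_trans (eq_leq (esym kE)) _; apply: leq_trans (eq_leq (esym cC)) _.
  by rewrite addnC leq_add2l.
pose R j := [set v | 0 < z j v].
have inR j v : (v \in R j) = z j v :> nat.
  by rewrite inE; have := z1 j v; case: (z j v) => [|[]].
exists R; split.
- move=> j; rewrite rowE -sum1_card big_mkcond; apply: eq_bigr => v _.
  by rewrite -inR; case: (v \in _).
- move=> v; apply/eqP; rewrite -(eqn_add2l (\sum_j z j v)) -colE -big_split /=.
  rewrite (eq_bigr (fun=> 1)) ?sum1_card ?card_ord // => j _.
  by rewrite -inR; case: (v \in _).
- move=> X X0; have -> : missing R X = #|[set j | [disjoint R j & X]]|.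
    rewrite -sum1_card big_mkcond; apply: eq_bigr => j _.
    by rewrite inE; case: [disjoint _ & _].
  set A := [set j | _]; have [->|A0] := eqVneq A set0; first by rewrite cards0.
  have := covP A X A0 X0; rewrite big1 // => j; rewrite inE => dj.
  apply: big1 => v vX; rewrite -inR.
  by have := disjointFl dj vX => ->.
Qed.

End RootSets.

(** * Branchings with prescribed sizes and in-degrees *)

Section Degrees.

Variables (V A : finType) (tl hd : A -> V) (m_in : V -> nat).

Hypothesis m_in_le : forall v, m_in v <= indeg tl hd [set: A] [set v].

Definition supply (X : {set V}) : nat :=
  if #|X| == 1 then \sum_(v in X) m_in v else indeg tl hd [set: A] X.

Lemma supply1 v : supply [set v] = m_in v.
Proof. by rewrite /supply cards1 big_set1. Qed.

Lemma supply_le X : supply X <= indeg tl hd [set: A] X.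
Proof. by rewrite /supply; case: ifP => // /cards1P[v ->]; rewrite big_set1. Qed.

(** Intersecting sets that are not nested are not singletons, so [supply] is the in-degree on the
    right, while on the left it can only be smaller. *)
Lemma supply_submod X Y : X :&: Y != set0 ->
  supply (X :&: Y) + supply (X :|: Y) <= supply X + supply Y.
Proof.
move=> XY0.
have [XY|nXY] := boolP (X \subset Y).
  by rewrite (setIidPl XY) (setUidPr XY).
have [YX|nYX] := boolP (Y \subset X).
  by rewrite (setIidPr YX) (setUidPl YX) addnC.
have big Z Z' : Z :&: Z' != set0 -> ~~ (Z \subset Z') -> supply Z =
  indeg tl hd [set: A] Z.
  move=> ZZ nZ; rewrite /supply; case: cards1P => // -[v Zv].
  by move: ZZ nZ; rewrite Zv setI_eq0 disjoints1 sub1set negbK => ->.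
rewrite (big X Y) // (big Y X) 1?setIC //.
apply: leq_trans (leq_add (supply_le _) (supply_le _)) _.
by rewrite [_ :&: _]setIC indeg_submod.
Qed.

(** The singletons in [P] make up [Y] and the other members [Q], which brings the sum into the form
    of the stated condition. *)
Lemma supply_subpartition (P : {set {set V}}) : trivIset P -> set0 \notin P ->
  exists (Y : {set V}) (Q : {set {set V}}), [/\ subpartition Q (~: Y),
    #|P| = #|Q| + #|Y|
    & \sum_(X in P) supply X =
        \sum_(v in Y) m_in v + \sum_(X in Q) indeg tl hd [set: A] X].
Proof.
move=> trP P0; pose Y := [set v | [set v] \in P].
have PY : [set X in P | #|X| == 1] = set1 @: Y.
  apply/setP => X; rewrite !inE; apply/andP/imsetP => [[XP /cards1P[v Xv]]|[v]].
    by exists v; rewrite // inE -Xv.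
  by rewrite inE => vP ->; rewrite cards1.
exists Y, [set X in P | #|X| != 1]; split.
- apply/and3P; split.
  + by apply: trivIsetS trP; apply/subsetP => X; rewrite inE => /andP[].
  + by rewrite inE (negbTE P0).
  + apply/bigcupsP => X; rewrite inE => /andP[XP X1].
    apply/subsetP => v vX; rewrite !inE; apply/negP => vP.
    have := trivIsetP trP _ _ XP vP; have [Xv|_] := eqVneq X [set v].
      by rewrite Xv cards1 in X1.
    by move=> /(_ isT); rewrite disjoint_sym disjoints1 vX.
- rewrite -(card_imset _ (@set1_inj V)) -PY -(cardsID [set X :
  {set V} | #|X| == 1] P) addnC.
  by congr (_ + _); apply: eq_card => X; rewrite !inE // andbC.
- rewrite (bigID (fun X : {set V} => #|X| == 1)) /=; congr (_ + _).
    rewrite -[LHS]big_set PY big_imset /=; last by move=> u v _ _;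
      apply: set1_inj.
    by apply: eq_bigr => v _; rewrite supply1.
  rewrite -[LHS]big_set; apply: eq_bigr => X; rewrite inE => /andP[_ X1].
  by rewrite /supply (negbTE X1).
Qed.

End Degrees.

Lemma pospart_bound (q y n m : nat) : m <= n ->
  ((q + y)%N%:Z <= (n - m)%N%:Z + pospart (q%:Z + y%:Z - (n%:Z - m%:Z)))%R.
Proof. by rewrite /pospart; lia. Qed.

Theorem theorem24 (V A : finType) (tl hd : A -> V) (k : nat)
    (m_in : V -> nat) (mu : 'I_k -> nat)
    (k_gt0 : 0 < k)
    (m_in_le_indeg : forall v, m_in v <= indeg tl hd [set: A] [set v])
    (m_in_le_k : forall v, m_in v <= k)
    (mu_gt0 : forall j, 0 < mu j)
    (sum_mu : \sum_(j < k) mu j = \sum_(v in [set: V]) m_in v) :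
  (exists (F : {set A}) (B : 'I_k -> {set A}),
      [/\ F = \bigcup_(j < k) B j,
          forall i j, i != j -> [disjoint B i & B j],
          forall j, branching tl hd (B j),
          forall j, #|B j| = mu j
        & forall v, indeg tl hd F [set v] = m_in v])
  <->
  (forall (Y : {set V}) (P : {set {set V}}),
      subpartition P (~: Y) ->
      (\sum_(j < k) pospart (#|P|%:Z + #|Y|%:Z - (#|V|%:Z - (mu j)%:Z)) <=
       (\sum_(v in Y) m_in v)%N%:Z +
       (\sum_(X in P) indeg tl hd [set: A] X)%N%:Z)%R).
Proof.
split=> [[F [B [FB disjB brB cardB degF]]] Y P subP|cond].
  have degY : \sum_(v in Y) m_in v =
    \sum_j \sum_(v in Y) indeg tl hd (B j) [set v].
    rewrite exchange_big; apply: eq_bigr => v _.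
    by rewrite -degF FB indeg_bigcup.
  have degP : \sum_j \sum_(X in P) indeg tl hd (B j) X <=
    \sum_(X in P) indeg tl hd [set: A] X.
    rewrite exchange_big; apply: leq_sum => X _.
    by rewrite -indeg_bigcup // indegS ?subsetT.
  apply: (@Order.POrderTheory.le_trans _ _ (Posz (\sum_j (\sum_(v in Y) indeg
    tl hd (B j) [set v]
      + \sum_(X in P) indeg tl hd (B j) X)))); last first.
    by rewrite -PoszD lez_nat big_split /= -degY leq_add2l.
  rewrite (big_morph Posz PoszD (erefl _)); apply: Num.Theory.ler_sum => j _.
  have := branching_bound (brB j) subP; have := branching_card (brB j);
    rewrite cardB.
  by rewrite /pospart; lia.
have j0 : 'I_k := Ordinal k_gt0.
have V_gt0 : 0 < #|V|.
  rewrite lt0n; apply/negP => /eqP V0.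
  have : \sum_(v in [set: V]) m_in v = 0 by apply: big1 => v;
    have := card0_eq V0 v.
  rewrite -sum_mu => /eqP; rewrite sum_nat_eq0 => /forallP/(_ j0).
  by have := mu_gt0 j0; case: (mu j0).
have pos_ge0 x : (0 <= pospart x)%R by rewrite /pospart; lia.
have mu_lt j : mu j < #|V|.
  (* No arc enters the whole node set, so the condition for empty [Y] and this single set makes
     every positive part vanish. *)
  have sub : @subpartition V [set setT] (~: set0).
    rewrite /subpartition /trivIset /cover !big_set1 setC0 subsetT eqxx inE /=.
    by rewrite eq_sym -card_gt0 cardsT V_gt0.
  have := cond _ _ sub; rewrite big_set0 big_set1 indeg_setT cards1 cards0
    (bigD1 j) //=.
  move=> le; have : (pospart (1%:Z + 0%:Z - (#|V|%:Z - (mu j)%:Z)) <= 0)%R.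
    by apply: Order.POrderTheory.le_trans le;
      rewrite Num.Theory.lerDl Num.Theory.sumr_ge0.
  rewrite /pospart Order.TotalTheory.ge_max Num.Theory.subr_le0 GRing.addr0 =>
    /andP[le1 _].
  by rewrite -lez_nat -addn1 addnC PoszD -Num.Theory.lerBrDr.
pose r j := #|V| - mu j.
have r_gt0 j : 0 < r j by rewrite subn_gt0.
have sum_rc : \sum_j r j + \sum_v supply tl hd m_in [set v] = k * #|V|.
  under [X in _ + X]eq_bigr => v _ do rewrite supply1.
  have -> : \sum_v m_in v = \sum_j mu j by rewrite sum_mu; apply: eq_bigl => v;
    rewrite inE.
  rewrite -big_split /= (eq_bigr (fun=> #|V|)) => [|j _];
    last by rewrite subnK // ltnW.
  by rewrite sum_nat_const card_ord.
have hall (J : {set 'I_k}) (P : {set {set V}}) : trivIset P -> set0 \notin P ->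
    #|J| * #|P| <= \sum_(j in J) r j + \sum_(X in P) supply tl hd m_in X.
  move=> trP P0; have [Y [Q [subQ -> ->]]] :=
    supply_subpartition tl hd m_in trP P0.
  have le := cond _ _ subQ.
  rewrite -lez_nat !PoszD; apply: Order.POrderTheory.le_trans (Num.Theory.lerD
    (Order.POrderTheory.lexx _) le).
  (* The positive parts outside [J] are dropped; each one inside is at least [#|Q| + #|Y| - r j]. *)
  rewrite [X in (_ <= _ + X)%R](bigID (mem J)) /=.
  rewrite -sum_nat_const !(big_morph Posz PoszD (erefl _)) GRing.addrA
    -big_split /=.
  apply: Num.Theory.ler_wpDr; first exact: Num.Theory.sumr_ge0.
  apply: Num.Theory.ler_sum => j _.
  exact: pospart_bound (ltnW (mu_lt j)).
have [R [cardR degR missR]] :=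
  root_sets (supply_submod m_in_le_indeg) r_gt0 sum_rc hall.
have [||B [_ disjB growB]] := @disjoint_branchings V A tl hd k [set: A] R.
- by move=> j; rewrite -card_gt0 cardR.
- by move=> X /missR le; apply: leq_trans le (supply_le _ _).
exists (\bigcup_(j < k) B j), B; split=> // [j|j|v].
- exact: grows_branching (growB j).
- have := grows_card (growB j); rewrite cardR /r; have := mu_lt j; lia.
(* Exactly the branchings whose root set omits [v] enter [v], and [degR] fixes their number. *)
- rewrite indeg_bigcup // -(supply1 tl hd m_in v) -degR.
  by apply: eq_bigr => j _; apply: grows_indeg.
Qed.
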